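(* Let $M_{\rm b},M_{\rm o}$ be positive integers and consider the quantity $\eta$ defined in the context as a function of $\widetilde{L}_{\rm o}$ only, $\eta=f(\widetilde{L}_{\rm o})$, the other parameters $\sigma_{\rm b},\sigma_{\rm o},M_{\rm b},M_{\rm o},\widetilde{L}_{\rm b/o}$ being fixed. Assume that $\widetilde{L}_{\rm o}$ has a lower bound such that $\widetilde{L}_{\rm o}\sqrt{2M_{\rm o}-1}>1/2$, and that condition (ii) in the definition of $\eta$ is not met, i.e., $M_{\rm o}\ge M_{\rm b}$. Then the minimum of the function $f$ is unique and reached when $$\left(1+4\widetilde{L}_{\rm o}^2\right)^{M_{\rm o}}=\left(1+4\widetilde{L}_{\rm b/o}^2\right)^{M_{\rm b}}.$$
   Context: The parameters are positive integers $M_{\rm b},M_{\rm o}$ (smoothness parameters of the background- and observation-error correlation models), positive standard deviations $\sigma_{\rm b},\sigma_{\rm o}$, and positive normalised length-scales $\widetilde{L}_{\rm b/o}=L_{\rm b}/h_{\rm o}$ and $\widetilde{L}_{\rm o}=L_{\rm o}/h_{\rm o}$, where $L_{\rm b},L_{\rm o}$ are the background- and observation-error correlation length-scales and $h_{\rm o}$ is the observation grid size. Let $\nu_{\rm b}=\nu(M_{\rm b})$ and $\nu_{\rm o}=\nu(M_{\rm o})$ with $\nu(M)=\dfrac{2^{2M-1}[(M-1)!]^2}{(2M-2)!}$, and $$\alpha=\frac{\sigma_{\rm b}^2\nu_{\rm b}\widetilde{L}_{\rm b/o}}{\sigma_{\rm o}^2\nu_{\rm o}\widetilde{L}_{\rm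 o}}$$ (so $\alpha$ depends on $\widetilde{L}_{\rm o}$). The quantity $\eta$, which is an upper bound on the condition number of a preconditioned Hessian matrix in data assimilation, is defined by $$\eta=1+\alpha\left(\frac{\widetilde{L}_{\rm o}^2}{M_{\rm b}}\right)^{M_{\rm b}}\left(\frac{M_{\rm o}}{\widetilde{L}_{\rm b/o}^2}\right)^{M_{\rm o}}\left(\frac{M_{\rm b}-M_{\rm o}}{\widetilde{L}_{\rm o}^2-\widetilde{L}_{\rm b/o}^2}\right)^{M_{\rm b}-M_{\rm o}}$$ if (i) $\widetilde{L}_{\rm o}^2M_{\rm o}>\widetilde{L}_{\rm b/o}^2M_{\rm b}$, (ii) $M_{\rm o}<M_{\rm b}$, and (iii) $\widetilde{L}_{\rm b/o}^2M_{\rm b}-\widetilde{L}_{\rm o}^2M_{\rm o}>4\widetilde{L}_{\rm b/o}^2\widetilde{L}_{\rm o}^2(M_{\rm o}-M_{\rm b})$ all hold, and $$\eta=1+\alpha\max\left\{\frac{(1+4\widetilde{L}_{\rm o}^2)^{M_{\rm o}}}{(1+4\widetilde{L}_{\rm b/o}^2)^{M_{\rm b}}},\;1\right\}$$ otherwise.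
   Formalization: Existence of the minimum is asserted only when the solution of the displayed equation itself satisfies the lower bound on L̃_o; otherwise (e.g. M_b = M_o = 1, L̃_b/o = 1/10) f has no minimum on the allowed range. *)

(* Defs.v *)
From mathcomp Require Import all_boot all_order all_algebra.
From mathcomp Require Import classical_sets reals.

Set Implicit Arguments.
Unset Strict Implicit.
Unset Printing Implicit Defensive.

Import Order.TTheory GRing.Theory Num.Theory.
Local Open Scope ring_scope.

Definition nu (R : realType) (M : nat) : R :=
  2 ^+ (2 * M - 1)%N * (((M - 1)`!)%:R) ^+ 2 / ((2 * M - 2)`!)%:R.

(* [Lb] and [Lo] are the background- and observation-error length-scales, both
   already divided by the observation grid size. *)
Definition alpha (R : realType) (Mb Mo : nat) (sigb sigo Lb Lo : R) : R :=
  (sigb ^+ 2 * nu R Mb * Lb) / (sigo ^+ 2 * nu R Mo * Lo).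

Definition cond_i (R : realType) (Mb Mo : nat) (Lb Lo : R) : bool :=
  Lb ^+ 2 * Mb%:R < Lo ^+ 2 * Mo%:R.

Definition cond_ii (Mb Mo : nat) : bool := (Mo < Mb)%N.

Definition cond_iii (R : realType) (Mb Mo : nat) (Lb Lo : R) : bool :=
  4 * Lb ^+ 2 * Lo ^+ 2 * (Mo%:R - Mb%:R) < Lb ^+ 2 * Mb%:R - Lo ^+ 2 * Mo%:R.

(* The truncated exponent [Mb - Mo] is only used under [cond_ii], where the
   subtraction is exact. *)
Definition eta (R : realType) (Mb Mo : nat) (sigb sigo Lb Lo : R) : R :=
  if [&& cond_i Mb Mo Lb Lo, cond_ii Mb Mo & cond_iii Mb Mo Lb Lo] then
    1 + alpha Mb Mo sigb sigo Lb Lo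
        * (Lo ^+ 2 / Mb%:R) ^+ Mb
        * (Mo%:R / Lb ^+ 2) ^+ Mo
        * ((Mb%:R - Mo%:R) / (Lo ^+ 2 - Lb ^+ 2)) ^+ (Mb - Mo)%N
  else
    1 + alpha Mb Mo sigb sigo Lb Lo
        * Num.max ((1 + 4 * Lo ^+ 2) ^+ Mo / (1 + 4 * Lb ^+ 2) ^+ Mb) 1.

Definition minimizer (R : realType) (f : R -> R) (D : set R) (x : R) : Prop :=
  D x /\ forall y, D y -> f x <= f y.

(* The lower bound on the length-scale is exactly the condition under which
   [x |-> (1 + 4 * x ^+ 2) ^+ Mo / x] has positive derivative at [Lo]. *)
Definition admissible (R : realType) (Mo : nat) : set R :=
  [set Lo : R | 0 < Lo /\ 1 / 2 < Lo * Num.sqrt (2 * Mo%:R - 1)]%classic.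
Arguments admissible R Mo _ : clear implicits.

(* Main.v *)
(* With [Mb <= Mo] the bound is [f x = 1 + K * max (g x / C) 1 / x], where
   [g x = (1 + 4 x^2)^Mo], [C = (1 + 4 Lb^2)^Mb] and [K > 0] does not depend
   on [x]. Left of the unique positive root [t] of [g = C], [f] is [1 + K / x],
   which decreases; right of it, [f] is [1 + K / C * (g x / x)], which
   increases on the admissible set. The admissible set is an open half-line,
   so [f] has no minimizer there when [t] lies outside it. *)
Require Import Defs.
From mathcomp Require Import all_boot all_order all_algebra.
From mathcomp Require Import classical_sets reals.
From mathcomp Require Import ring lra.

Set Implicit Arguments.
Unset Strict Implicit.
Unset Printing Implicit Defensive.

Import Order.TTheory GRing.Theory Num.Theory.
Local Open Scope ring_scope.

Lemma bernoulli_ge (R : realDomainType) (a : R) (n : nat) :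
  0 <= a -> 1 + n%:R * a <= (1 + a) ^+ n.
Proof.
move=> a0; elim: n => [|n IHn]; first by rewrite mul0r addr0 expr0.
have n0 : (0 : R) <= n%:R by [].
have a1 : 0 <= 1 + a by lra.
rewrite exprSr; apply: le_trans (ler_wpM2r a1 IHn).
rewrite -natr1; nra.
Qed.

(** The polynomial ['X^n - c] changes sign on [[1, c]], since [1 <= c <= c ^+ n]; the intermediate
    value theorem gives the root. *)
Lemma exists_nthroot_ge1 (R : rcfType) (n : nat) (c : R) :
  (0 < n)%N -> 1 <= c -> exists2 s : R, 1 <= s & s ^+ n = c.
Proof.
move=> n0 c1.
have [|s /andP[s1 _] /rootP] := @poly_ivt R ('X^n - c%:P) 1 c c1.
  by rewrite !hornerE expr1n subr_le0 c1 subr_ge0 ler_eXnr.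
by rewrite !hornerE => /eqP; rewrite subr_eq0 => /eqP sn; exists s.
Qed.

Lemma growth_ltE (R : realFieldType) (n : nat) (x y : R) :
  (0 < n)%N -> 0 < x -> 0 < y ->
  ((1 + 4 * x ^+ 2) ^+ n < (1 + 4 * y ^+ 2) ^+ n) = (x < y).
Proof.
move=> n0 x0 y0.
have nneg (z : R) : 1 + 4 * z ^+ 2 \is Num.nneg.
  by rewrite nnegrE addr_ge0 // mulr_ge0 // sqr_ge0.
by rewrite ltr_pXn2r // ltrD2l ltr_pM2l // ltr_pXn2r // nnegrE ltW.
Qed.

Lemma growth_inj (R : realFieldType) (n : nat) (x y : R) :
  (0 < n)%N -> 0 < x -> 0 < y ->
  (1 + 4 * x ^+ 2) ^+ n = (1 + 4 * y ^+ 2) ^+ n -> x = y.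
Proof.
move=> n0 x0 y0 exy; apply/eqP; rewrite eq_le !leNgt.
by rewrite -(growth_ltE n0 x0 y0) -(growth_ltE n0 y0 x0) exy ltxx.
Qed.

(* Bernoulli bounds [((1 + 4 y^2) / (1 + 4 x^2))^n] below by
   [1 + 4 n (y^2 - x^2) / (1 + 4 x^2)], which exceeds
   [(x^2 + y^2) / (2 x^2)] by the hypothesis, hence [y / x] by AM-GM. *)
Lemma growth_div_lt (R : realFieldType) (n : nat) (x y : R) :
  0 < x -> x < y -> 1 + 4 * x ^+ 2 < 8 * n%:R * x ^+ 2 ->
  (1 + 4 * x ^+ 2) ^+ n / x < (1 + 4 * y ^+ 2) ^+ n / y.
Proof.
move=> x0 xy hx; have y0 : 0 < y by lra.
have u0 : 0 < 1 + 4 * x ^+ 2 by nra.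
have d0 : 0 < y ^+ 2 - x ^+ 2 by nra.
pose a := 4 * (y ^+ 2 - x ^+ 2) / (1 + 4 * x ^+ 2).
have a0 : 0 <= a by rewrite divr_ge0 ?ltW // mulr_gt0.
have Ey : 1 + 4 * y ^+ 2 = (1 + 4 * x ^+ 2) * (1 + a).
  by rewrite /a; field; rewrite gt_eqF.
have na : (y ^+ 2 - x ^+ 2) / (2 * x ^+ 2) < n%:R * a.
  rewrite /a ltr_pdivrMr; last nra.
  have -> : n%:R * (4 * (y ^+ 2 - x ^+ 2) / (1 + 4 * x ^+ 2)) * (2 * x ^+ 2) =
    (y ^+ 2 - x ^+ 2) * (8 * n%:R * x ^+ 2) / (1 + 4 * x ^+ 2).
    by field; rewrite gt_eqF.
  by rewrite ltr_pdivlMr // ltr_pM2l.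
have yx : y / x <= 1 + (y ^+ 2 - x ^+ 2) / (2 * x ^+ 2).
  rewrite -subr_ge0.
  have -> : 1 + (y ^+ 2 - x ^+ 2) / (2 * x ^+ 2) - y / x =
            (y - x) ^+ 2 / (2 * x ^+ 2) by field; rewrite gt_eqF.
  by rewrite divr_ge0 ?sqr_ge0 // mulr_ge0 ?sqr_ge0.
have r_gt : y / x < (1 + a) ^+ n.
  apply: lt_le_trans (bernoulli_ge n a0); lra.
rewrite Ey exprMn -mulrA ltr_pM2l ?exprn_gt0 //.
by rewrite ltr_pdivlMr // mulrC.
Qed.

(** Squaring the lower bound gives [1 / 4 < x ^+ 2 * (2 * n - 1)], where [0 < n] makes the radicand
    nonnegative. Multiplying by 4 yields the sign condition on the derivative of
    [(1 + 4 * x ^+ 2) ^+ n / x]. *)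
Lemma admissible_growth (R : realType) (n : nat) (x : R) :
  (0 < n)%N -> admissible R n x -> 1 + 4 * x ^+ 2 < 8 * n%:R * x ^+ 2.
Proof.
move=> n0 [x0 hx]; have n1 : (1 : R) <= n%:R by rewrite ler1n.
have s2 : Num.sqrt (2 * n%:R - 1) ^+ 2 = 2 * n%:R - 1 :> R.
  by rewrite sqr_sqrtr //; lra.
have : (1 / 2) ^+ 2 < (x * Num.sqrt (2 * n%:R - 1)) ^+ 2.
  by rewrite ltr_pXn2r // nnegrE ?divr_ge0 // mulr_ge0 ?sqrtr_ge0 // ltW.
rewrite [ltRHS]exprMn s2; lra.
Qed.

Lemma admissible_le (R : realType) (n : nat) (x y : R) :
  x <= y -> admissible R n x -> admissible R n y.
Proof.
move=> xy [x0 hx]; split; first exact: lt_le_trans xy.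
by apply: lt_le_trans hx _; rewrite ler_wpM2r ?sqrtr_ge0.
Qed.

(** With [s] the square root, the set is the open half-line above [1 / 2 / s]; the midpoint between
    this endpoint and [x] serves as [z]. *)
Lemma admissible_open (R : realType) (n : nat) (x : R) :
  admissible R n x -> exists2 z, admissible R n z & z < x.
Proof.
move=> [x0 hx]; set s := Num.sqrt _ in hx.
have s0 : 0 < s.
  (* A zero root, which is also the default value on negative radicands, would turn [hx] into
     [1 / 2 < 0]. *)
  rewrite lt_neqAle sqrtr_ge0 andbT eq_sym; apply/eqP => s0.
  by move: hx; rewrite s0; lra.
have hz : 1 / 2 / s < x by rewrite ltr_pdivrMr.
have z0 : 0 < 1 / 2 / s by rewrite !divr_gt0.
exists ((x + 1 / 2 / s) / 2); last lra.
split; first lra.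
rewrite -/s -ltr_pdivrMr //; lra.
Qed.

Lemma nu_gt0 (R : realType) (M : nat) : 0 < nu R M.
Proof. by rewrite /nu divr_gt0 ?mulr_gt0 ?exprn_gt0 ?ltr0n ?fact_gt0. Qed.

(** Failure of (ii) selects the second branch of [eta]; [K] is [alpha] with its only dependence on
    [x], the factor [1 / x], taken out. *)
Lemma eta_notii (R : realType) (Mb Mo : nat) (sigb sigo Lb : R) :
  0 < sigb -> 0 < sigo -> 0 < Lb -> ~~ cond_ii Mb Mo ->
  exists2 K : R, 0 < K & forall x, eta Mb Mo sigb sigo Lb x =
    1 + K * (Num.max ((1 + 4 * x ^+ 2) ^+ Mo / (1 + 4 * Lb ^+ 2) ^+ Mb) 1 / x).
Proof.
move=> b0 o0 L0 /negbTE nii.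
exists (sigb ^+ 2 * nu R Mb * Lb / (sigo ^+ 2 * nu R Mo)).
  have [nub nuo] := (nu_gt0 R Mb, nu_gt0 R Mo).
  by apply: divr_gt0; do ?[assumption | apply: mulr_gt0].
move=> x; rewrite /eta nii andbF /alpha.
by rewrite [(_ * x)^-1]invfM [Num.max _ _ / x]mulrC !mulrA.
Qed.

Theorem corollary1 (R : realType) (Mb Mo : nat) (sigb sigo Lb : R)
    (Mb_gt0 : (0 < Mb)%N) (Mo_gt0 : (0 < Mo)%N)
    (sigb_gt0 : 0 < sigb) (sigo_gt0 : 0 < sigo) (Lb_gt0 : 0 < Lb)
    (not_ii : ~~ cond_ii Mb Mo) :
  let f := fun Lo : R => eta Mb Mo sigb sigo Lb Lo in
  let D := admissible R Mo in
  let crossing := fun Lo : R =>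
    (1 + 4 * Lo ^+ 2) ^+ Mo = (1 + 4 * Lb ^+ 2) ^+ Mb in
  [/\ (exists! Lo : R, 0 < Lo /\ crossing Lo),
      ((exists Lo : R, D Lo /\ crossing Lo) ->
         exists! Lo : R, minimizer f D Lo)
    & (forall Lo : R, D Lo -> (minimizer f D Lo <-> crossing Lo))].
Proof.
move=> f D crossing; rewrite /crossing.
have [K K0 fE] := eta_notii sigb_gt0 sigo_gt0 Lb_gt0 not_ii.
set C := (1 + 4 * Lb ^+ 2) ^+ Mb in fE *.
have C1 : 1 < C by rewrite exprn_egt1 -?lt0n //; nra.
have C0 : 0 < C by lra.
have [t t0 gt] : exists2 t : R, 0 < t & (1 + 4 * t ^+ 2) ^+ Mo = C.
  have [s s1 sC] := exists_nthroot_ge1 Mo_gt0 (ltW C1).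
  have {}s1 : 1 < s.
    rewrite lt_neqAle s1 andbT; apply: contraTneq C1 => s1'.
    by rewrite -sC -s1' expr1n ltxx.
  (* Solves [1 + 4 * t ^+ 2 = s] for the [Mo]-th root [s] of [C]; the strict bound [1 < s] makes [t]
     positive. *)
  exists (Num.sqrt ((s - 1) / 4)); first by rewrite sqrtr_gt0; lra.
  by rewrite sqr_sqrtr -?sC; [congr (_ ^+ _); lra | lra].
have crossE x : 0 < x -> (1 + 4 * x ^+ 2) ^+ Mo = C -> x = t.
  by move=> x0; rewrite -gt; exact: growth_inj.
have f_lt x y : (f x < f y) =
    (Num.max ((1 + 4 * x ^+ 2) ^+ Mo / C) 1 / x
     < Num.max ((1 + 4 * y ^+ 2) ^+ Mo / C) 1 / y).
  by rewrite /f !fE ltrD2l ltr_pM2l.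
have maxl x : 0 < x -> x <= t -> Num.max ((1 + 4 * x ^+ 2) ^+ Mo / C) 1 = 1.
  move=> x0 xt; apply: max_r.
  by rewrite ler_pdivrMr // mul1r -gt leNgt growth_ltE // -leNgt.
have maxr x : t <= x ->
    Num.max ((1 + 4 * x ^+ 2) ^+ Mo / C) 1 = (1 + 4 * x ^+ 2) ^+ Mo / C.
  move=> tx; have x0 := lt_le_trans t0 tx.
  apply: max_l.
  by rewrite ler_pdivlMr // mul1r -gt leNgt growth_ltE // -leNgt.
have decr x y : 0 < x -> x < y -> y <= t -> f y < f x.
  move=> x0 xy yt; have y0 := lt_trans x0 xy.
  by rewrite f_lt !maxl ?(le_trans (ltW xy)) // !div1r ltf_pV2.
have incr x y : D x -> t <= x -> x < y -> f x < f y.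
  move=> Dx tx xy; rewrite f_lt !maxr ?(le_trans tx (ltW xy)) //.
  rewrite ![_ / C / _]mulrAC ltr_pM2r ?invr_gt0 //.
  by apply: growth_div_lt => //; [case: Dx | exact: admissible_growth].
have mint : D t -> minimizer f D t.
  move=> Dt; split=> // y Dy; have y0 : 0 < y by case: Dy.
  by have [yt|ty|->] := ltgtP y t; [exact/ltW/decr | exact/ltW/incr |].
have mincross x : minimizer f D x -> x = t.
  move=> [Dx xmin]; have x0 : 0 < x by case: Dx.
  have [xt|tx|//] := ltgtP x t.
    (* Left of [t]: the point [t] is admissible too, by upward closure, and has a smaller value. *)
    have := xmin t (admissible_le (ltW xt) Dx).
    by rewrite leNgt decr.
  (* Right of [t]: moving left to an admissible [z], but no further than [t], stays on the
     increasing branch and lowers the value. *)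
  have [z Dz zx] := admissible_open Dx.
  have Dy : D (Num.max z t) by apply: admissible_le Dz; rewrite le_max lexx.
  have := xmin _ Dy.
  by rewrite leNgt incr // ?le_max ?lexx ?orbT // gt_max zx.
split.
- by exists t; split=> // x [x0 /crossE ->].
(* The assumed admissible crossing point is [t] itself, so [t] is admissible. *)
- move=> [x [Dx cx]]; exists t; split; last by move=> y /mincross.
  by apply: mint; rewrite -(crossE x) //; case: Dx.
- move=> x Dx; split=> [/mincross -> //|cx].
  have xt : x = t by apply: crossE => //; case: Dx.
  by rewrite xt; apply: mint; rewrite -xt.
Qed.
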